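(* Let $(D,X)$ be a Dyer system. Every element of $D$ admits a parabolic closure, i.e. for every $g\in D$ there exists an inclusion-wise smallest parabolic subgroup of $D$ containing $g$.
   Context: A Dyer graph is a finite simplicial graph $\Gamma$ with vertex set $V(\Gamma)$ and edge set $E(\Gamma)$, together with a vertex labelling $f\colon V(\Gamma)\to\mathbb{N}_{\geq 2}\cup\{\infty\}$ and an edge labelling $m\colon E(\Gamma)\to\mathbb{N}_{>2}\cup\{\infty\}$ such that for every edge $\{u,v\}\in E(\Gamma)$, if $f(v)\geq 3$ (including $f(v)=\infty$), then $m(u,v)=\infty$. The labelling $m$ is extended to all pairs of distinct vertices by $m(u,v)=2$ if $\{u,v\}\notin E(\Gamma)$. The associated Dyer group is $$D(\Gamma)=\langle V(\Gamma)\mid v^{f(v)}=1 \text{ for all } v \text{ with } f(v)<\infty,\ \underbrace{uvu\cdots}_{m(u,v)\text{ terms}}=\underbrace{vuv\cdots}_{m(u,v)\text{ terms}}\text{ for all } \{u,v\}\text{ with } m(u,v)\neq\infty\rangle.$$ A Dyer system is a pair $(D,X)$ where $D$ is a group and $X\subseteq D$ is a generating set such that there exist a Dyer graph $\Gamma$ and a group isomorphism $D(\Gamma)\to D$ mapping $V(\Gamma)$ bijectively onto $X$. For $Y\subseteq X$, $D_Y$ denotes the subgroup of $D$ generated by $Y$. A parabolic subgroup of $D$ (with respect to $X$) is a subgroup of the form $gD_Yg^{-1}$ with $g\in D$ and $Y\subseteq X$. *)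

(* Defs.v *)
From HB Require Import structures.
From mathcomp Require Import all_boot.
From mathcomp Require Import boolp classical_sets functions.

Set Implicit Arguments.
Unset Strict Implicit.
Unset Printing Implicit Defensive.

Local Open Scope classical_set_scope.
Local Open Scope quotient_scope.
Local Open Scope group_scope.

(** Group presentations.  A word over [S] is a list of letters [(s, b)], where
    [(s, true)] stands for [s] and [(s, false)] for its formal inverse; a set
    of relations [w = w'] is a binary predicate on words. *)

Definition word (S : choiceType) := seq (S * bool).

Section Presentation.
Variables (S : choiceType) (R : word S -> word S -> Prop).

(** The least congruence on words that contains [R] and free cancellation. *)
Inductive pres_eq : word S -> word S -> Prop :=
| pres_refl w : pres_eq w w
| pres_sym w w' : pres_eq w w' -> pres_eq w' w
| pres_trans w w' w'' : pres_eq w w' -> pres_eq w' w'' -> pres_eq w w''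
| pres_cat u u' w w' : pres_eq u u' -> pres_eq w w' -> pres_eq (u ++ w) (u' ++ w')
| pres_cancel s b : pres_eq [:: (s, b); (s, ~~ b)] [::]
| pres_rel w w' : R w w' -> pres_eq w w'.

Definition pres_eqb (w w' : word S) : bool := `[< pres_eq w w' >].

Lemma pres_eqb_refl : reflexive pres_eqb.
Proof. by move=> w; apply/asboolP/pres_refl. Qed.

Lemma pres_eqb_sym : symmetric pres_eqb.
Proof. by move=> w w'; apply/asboolP/asboolP => /pres_sym. Qed.

Lemma pres_eqb_trans : transitive pres_eqb.
Proof.
move=> w' w w'' /asboolP ww' /asboolP w'w''.
by apply/asboolP; apply: pres_trans w'w''.
Qed.

Canonical pres_equiv := EquivRel pres_eqb pres_eqb_refl pres_eqb_sym pres_eqb_trans.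

(** The group < S | R >. *)
Definition pres_group := {eq_quot pres_equiv}.
HB.instance Definition _ := Choice.on pres_group.
HB.instance Definition _ := EqQuotient.on pres_group.

Definition pres_class (w : word S) : pres_group := \pi w.

Lemma pres_classP w w' : pres_class w = pres_class w' <-> pres_eq w w'.
Proof.
split=> [/eqquotP|] e; first exact/asboolP.
by apply/eqquotP/asboolP.
Qed.

Lemma pres_class_repr (x : pres_group) : pres_class (repr x) = x.
Proof. exact: reprK. Qed.

Lemma pres_repr_class w : pres_eq (repr (pres_class w)) w.
Proof. by apply/pres_classP; rewrite pres_class_repr. Qed.

Definition word_inv (w : word S) : word S := rev [seq (l.1, ~~ l.2) | l <- w].

Lemma word_inv_cat u w : word_inv (u ++ w) = word_inv w ++ word_inv u.
Proof. by rewrite /word_inv map_cat rev_cat. Qed.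

Lemma word_invK : involutive word_inv.
Proof.
move=> w; rewrite /word_inv map_rev revK -map_comp -[RHS]map_id.
by apply: eq_map => -[s b] /=; rewrite negbK.
Qed.

Lemma pres_mulwV w : pres_eq (w ++ word_inv w) [::].
Proof.
elim: w => [|[s b] w IH]; first exact: pres_refl.
rewrite -cat1s word_inv_cat -catA [w ++ _]catA.
apply: pres_trans (pres_cancel s b).
exact: pres_cat (pres_refl [:: (s, b)]) (pres_cat IH (pres_refl _)).
Qed.

Lemma pres_mulVw w : pres_eq (word_inv w ++ w) [::].
Proof. by rewrite -{2}[w]word_invK; apply: pres_mulwV. Qed.

Lemma pres_eq_inv w w' : pres_eq w w' -> pres_eq (word_inv w) (word_inv w').
Proof.
move=> e; rewrite -[word_inv w]cats0.
apply: (@pres_trans _ (word_inv w ++ (w' ++ word_inv w'))).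
  exact: pres_cat (pres_refl _) (pres_sym (pres_mulwV _)).
rewrite catA; apply: (@pres_trans _ ((word_inv w ++ w) ++ word_inv w')).
  exact: pres_cat (pres_cat (pres_refl _) (pres_sym e)) (pres_refl _).
exact: pres_cat (pres_mulVw w) (pres_refl (word_inv w')).
Qed.

Definition pres_one : pres_group := pres_class [::].
Definition pres_mul (x y : pres_group) := pres_class (repr x ++ repr y).
Definition pres_inv (x : pres_group) := pres_class (word_inv (repr x)).

Lemma pres_mulA : associative pres_mul.
Proof.
move=> x y z; apply/pres_classP.
apply: (@pres_trans _ (repr x ++ (repr y ++ repr z))).
  exact: pres_cat (pres_refl _) (pres_repr_class _).
by rewrite catA; apply: pres_cat (pres_sym (pres_repr_class _)) (pres_refl _).
Qed.

Lemma pres_mul1 : left_id pres_one pres_mul.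
Proof.
move=> x; rewrite -[RHS]pres_class_repr; apply/pres_classP.
exact: pres_cat (pres_repr_class _) (pres_refl (repr x)).
Qed.

Lemma pres_mulr1 : right_id pres_one pres_mul.
Proof.
move=> x; rewrite -[RHS]pres_class_repr; apply/pres_classP.
by rewrite -[X in pres_eq _ X]cats0; apply: pres_cat (pres_refl _) (pres_repr_class _).
Qed.

Lemma pres_mulV : left_inverse pres_one pres_inv pres_mul.
Proof.
move=> x; apply/pres_classP; apply: pres_trans (pres_mulVw (repr x)).
exact: pres_cat (pres_repr_class _) (pres_refl _).
Qed.

Lemma pres_mulrV : right_inverse pres_one pres_inv pres_mul.
Proof.
move=> x; apply/pres_classP; apply: pres_trans (pres_mulwV (repr x)).
exact: pres_cat (pres_refl _) (pres_repr_class _).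
Qed.

HB.instance Definition _ :=
  isGroup.Build pres_group pres_mulA pres_mul1 pres_mulr1 pres_mulV pres_mulrV.

Definition pres_gen (s : S) : pres_group := pres_class [:: (s, true)].

Lemma pres_class_cat u w : pres_class (u ++ w) = pres_class u * pres_class w.
Proof.
apply/pres_classP.
exact: pres_cat (pres_sym (pres_repr_class _)) (pres_sym (pres_repr_class _)).
Qed.

End Presentation.

(** Labels in [nat] extended by infinity, with [None] for infinity. *)
Definition label := option nat.
Definition label_ge (k : nat) (a : label) : bool :=
  if a is Some n then k <= n else true.

(** [dyer_m] is only meaningful on edges; [dyer_ext_m] is the extension of the
    edge labelling to all pairs of distinct vertices. *)
Record dyer_graph := DyerGraph {
  dyer_vertex : finType;
  dyer_edge : rel dyer_vertex;
  dyer_f : dyer_vertex -> label;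
  dyer_m : dyer_vertex -> dyer_vertex -> label;
  dyer_edge_sym : symmetric dyer_edge;
  dyer_edge_irr : irreflexive dyer_edge;
  dyer_f_ge2 : forall v, label_ge 2 (dyer_f v);
  dyer_m_sym : forall u v, dyer_edge u v -> dyer_m u v = dyer_m v u;
  dyer_m_gt2 : forall u v, dyer_edge u v -> label_ge 3 (dyer_m u v);
  dyer_f_m : forall u v,
    dyer_edge u v -> label_ge 3 (dyer_f v) -> dyer_m u v = None
}.

Definition dyer_ext_m (G : dyer_graph) (u v : dyer_vertex G) : label :=
  if dyer_edge u v then dyer_m u v else Some 2.

(** The word [u v u ...] with [n] letters. *)
Definition alt_word (S : choiceType) (u v : S) (n : nat) : word S :=
  mkseq (fun i => (if odd i then v else u, true)) n.

Inductive dyer_rel (G : dyer_graph) :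
    word (dyer_vertex G) -> word (dyer_vertex G) -> Prop :=
| dyer_rel_power v n : dyer_f v = Some n -> dyer_rel (nseq n (v, true)) [::]
| dyer_rel_braid u v n : u != v -> dyer_ext_m u v = Some n ->
    dyer_rel (alt_word u v n) (alt_word v u n).

Definition dyer_group (G : dyer_graph) : groupType := pres_group (@dyer_rel G).

Definition dyer_gen (G : dyer_graph) (v : dyer_vertex G) : dyer_group G :=
  pres_gen (@dyer_rel G) v.

Section DyerSystem.
Variable D : groupType.

Definition is_subgroup (H : set D) : Prop := group_closed (mem H).

Definition gen_subgroup (Y : set D) : set D := smallest is_subgroup Y.

Definition dyer_system (X : set D) : Prop :=
  gen_subgroup X = setT /\
  exists (G : dyer_graph) (phi : {multiplicative dyer_group G -> D}),
    bijective phi /\ set_bij setT X (fun v => phi (dyer_gen v)).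

Definition parabolic (X P : set D) : Prop :=
  exists (g : D) (Y : set D),
    Y `<=` X /\ P = [set g * h * g^-1 | h in gen_subgroup Y].

(** [P] is the inclusion-wise smallest parabolic subgroup containing [g]. *)
Definition parabolic_closure (X : set D) (g : D) (P : set D) : Prop :=
  [/\ parabolic X P, P g & forall Q, parabolic X Q -> Q g -> P `<=` Q].

End DyerSystem.

(* Main.v *)
(** As for Coxeter groups, the key is a cocycle on walls: a function [N g r]
    with [N (g h) r = N g r * (N h (r ^ g)) ^ g^-1], whose value on a generator
    [v] is [v] at [r = v] and [1] elsewhere.  It respects the Dyer relations
    because a braid relation of length at least 3 only involves involutions, and
    the two sides then cross the same reflections in opposite orders.

    If [N g r != 1], all letters of a word for [g] crossing [r] can be deleted
    at the cost of a power of [r].  Hence if [d] is shortest in the coset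
    [D_Y d], then [N d] vanishes on [D_Y], and comparing both sides of
    [x d = d (x ^ d)] shows that the intersection of [D_Y] with [d D_Z d^-1] is
    generated by the elements of [Y] it contains.  So the intersection of two
    parabolic subgroups [g D_Y g^-1] and [Q] is conjugate to some [D_Y'] with
    [Y'] included in [Y], and a parabolic subgroup of least rank containing an
    element is its closure. *)

Require Import Defs.
From mathcomp Require Import all_boot.
From mathcomp Require Import boolp classical_sets functions.

Set Implicit Arguments.
Unset Strict Implicit.
Unset Printing Implicit Defensive.

(** * Subgroups, generation and words *)

Section Subgroups.
Local Open Scope group_scope.
Local Open Scope classical_set_scope.
Variable D : groupType.
Implicit Types (H Y : set D) (g h r s t : D).

Lemma is_subgroupP H :
  is_subgroup H <-> H 1 /\ (forall u v, H u -> H v -> H (u / v)).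
Proof.
split=> [[H1 HB]|[H1 HB]].
  split; first by move: H1; rewrite !inE.
  by move=> u v Hu Hv; have := HB u v; rewrite !inE; apply.
split; first by rewrite !inE.
by move=> u v; rewrite !inE; apply: HB.
Qed.

Lemma subgroup1 H : is_subgroup H -> H 1.
Proof. by case/is_subgroupP. Qed.

Lemma subgroupV H g : is_subgroup H -> H g -> H g^-1.
Proof. by case/is_subgroupP=> H1 HB Hg; rewrite -[_^-1]mul1g; apply: HB. Qed.

Lemma subgroupM H g h : is_subgroup H -> H g -> H h -> H (g * h).
Proof.
move=> sgH Hg Hh; rewrite -[h]invgK; case/is_subgroupP: (sgH) => _; apply=> //.
exact: subgroupV.
Qed.

Lemma subgroupMl H g h : is_subgroup H -> H g -> H (g * h) -> H h.
Proof.
move=> sgH Hg Hgh; rewrite -[h](mulKg g).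
by apply: subgroupM => //; apply: subgroupV.
Qed.

Lemma subgroupJ H r g : is_subgroup H -> H r -> H g -> H (r ^ g).
Proof.
by move=> sgH Hr Hg; do !apply: subgroupM => //; apply: subgroupV.
Qed.

Lemma subgroup_conj H g :
  is_subgroup H -> is_subgroup [set x | H (x ^ g)].
Proof.
move=> sgH; apply/is_subgroupP; split=> [|u v Hu Hv] /=.
  by rewrite conj1g; apply: subgroup1.
by rewrite conjMg conjVg; apply: subgroupM => //; apply: subgroupV.
Qed.

Lemma subgroup_centralizer r : is_subgroup [set x | commute r x].
Proof.
apply/is_subgroupP; split=> [|u v ru rv] /=; first exact: commute1.
by apply: commuteM => //; apply: commuteV.
Qed.

Lemma gen_is_subgroup Y : is_subgroup (gen_subgroup Y).
Proof.
apply/is_subgroupP; split=> [M [sgM _]|u v Yu Yv M [sgM YM]].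
  exact: subgroup1.
apply: subgroupM => //; first by apply: Yu.
by apply: subgroupV => //; apply: Yv.
Qed.

Lemma mem_gen Y s : Y s -> gen_subgroup Y s.
Proof. by move=> Ys M [_]; apply. Qed.

Lemma gen_subset H Y : is_subgroup H -> Y `<=` H -> gen_subgroup Y `<=` H.
Proof. by move=> sgH YH; apply: smallest_sub. Qed.

(** A relation, not the minimal length: some word of exactly [n] letters from [Y] and their inverses
    represents the element. *)
Inductive word_length Y : nat -> D -> Prop :=
| word_length0 : word_length Y 0 1
| word_lengthS n s t g : Y s -> t = s \/ t = s^-1 ->
    word_length Y n g -> word_length Y n.+1 (t * g).

Lemma word_length_cat Y m n g h :
  word_length Y m g -> word_length Y n h -> word_length Y (m + n) (g * h).
Proof.
move=> + wh; elim=> [|k s t g' Ys ts _ IH]; first by rewrite mul1g.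
by rewrite -mulgA addSn; apply: word_lengthS ts IH.
Qed.

Lemma word_length1 Y s t : Y s -> t = s \/ t = s^-1 -> word_length Y 1 t.
Proof.
by move=> Ys ts; rewrite -[t]mulg1; apply: word_lengthS ts (word_length0 Y).
Qed.

Lemma word_lengthV Y n g : word_length Y n g -> word_length Y n g^-1.
Proof.
elim=> [|k s t g' Ys ts _ IH]; first by rewrite invg1; constructor.
rewrite invgM -addn1; apply: word_length_cat IH (word_length1 Ys _).
by case: ts => ->; [right | left; rewrite invgK].
Qed.

Lemma word_length_sub Y Z n g :
  Y `<=` Z -> word_length Y n g -> word_length Z n g.
Proof.
move=> YZ; elim=> [|k s t g' Ys ts _ IH]; first exact: word_length0.
by apply: word_lengthS ts IH; apply: YZ.
Qed.

Lemma gen_word_length Y g :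
  gen_subgroup Y g <-> exists n, word_length Y n g.
Proof.
have sgY := gen_is_subgroup Y.
split=> [|[n]]; last first.
  elim=> [|k s t g' Ys ts _ IH]; first exact: subgroup1 sgY.
  apply: (subgroupM sgY _ IH).
  by case: ts => ->; [|apply: (subgroupV sgY)]; apply: mem_gen.
apply: (@gen_subset [set g | exists n, word_length Y n g] Y) => [|s Ys].
  apply/is_subgroupP; split=> [|u v [m wu] [n wv]].
    by exists 0%N; apply: word_length0.
  by exists (m + n)%N; apply: word_length_cat wu (word_lengthV wv).
by exists 1%N; apply: (word_length1 Ys); left.
Qed.

End Subgroups.

(** * Deletion and coset representatives for an abstract wall cocycle *)

Section WallCocycle.
Local Open Scope group_scope.
Local Open Scope classical_set_scope.
Variables (D : groupType) (X : set D) (N : D -> D -> D).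
Hypothesis genX : gen_subgroup X = setT.
Hypothesis NM : forall g h r, N (g * h) r = N g r * N h (r ^ g) ^ g^-1.
Hypothesis NX : forall s r, X s -> N s r = if r == s then s else 1.
Implicit Types (H Y Z : set D) (g h r s t : D).

Lemma cocycle1 r : N 1 r = 1.
Proof.
by apply: (@mulgI _ (N 1 r)); rewrite mulg1 -{3}(mulg1 1) NM invg1 !conjg1.
Qed.

Lemma cocycle_letter s t r :
  X s -> t = s \/ t = s^-1 -> N t r = if r == s then t else 1.
Proof.
move=> Xs [] ->; first exact: NX.
have Jss : s ^ s = s by rewrite conjgE mulKg.
(* The value on [s^-1] is forced by expanding [N (s^-1 * s) r = 1]. *)
have := NM s^-1 s r; rewrite mulVg cocycle1 (NX _ Xs) invgK => e.
have -> : N s^-1 r = ((if r ^ s^-1 == s then s else 1) ^ s)^-1.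
  by apply/eqP; rewrite -mulg_eq1 -e.
rewrite -[r ^ s^-1 == s](inj_eq (@conjg_inj _ s)) conjgKV Jss.
by case: eqP; rewrite ?Jss ?conj1g ?invg1.
Qed.

Lemma letter_fix s t : t = s \/ t = s^-1 -> s ^ t = s.
Proof. by case=> ->; rewrite conjgE ?mulKg // invgK mulgV mulg1. Qed.

(** Each letter crossing the wall [r] contributes [r] or [r^-1], so [N g r] is a power of [r].
    Quantifying over the subgroups containing [r] avoids exponents; [H] must vary in the induction,
    since moving past a letter conjugates it. *)
Lemma cocycle_mem H n g r :
  word_length X n g -> is_subgroup H -> H r -> H (N g r).
Proof.
move=> wg; elim: wg H r => [|k s t g' Xs ts _ IH] H r sgH Hr.
  by rewrite cocycle1; apply: subgroup1.
rewrite NM (cocycle_letter _ Xs ts); apply: subgroupM => //.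
  case: eqP => [rs|_]; last exact: subgroup1.
  by case: ts => ->; [|apply: (subgroupV sgH)]; rewrite -rs.
apply: (IH [set x | H (x ^ t^-1)]) => /=; first exact: subgroup_conj.
by rewrite conjgK.
Qed.

Lemma cocycle_commute n g r : word_length X n g -> commute r (N g r).
Proof.
by move=> wg; apply: cocycle_mem wg (subgroup_centralizer r) (commute_refl r).
Qed.

Lemma cocycle_letter_fix n g s t : word_length X n g ->
  t = s \/ t = s^-1 -> N g s ^ t^-1 = N g s.
Proof.
move=> /(cocycle_commute s)/commute_sym c ts.
suff ct : commute (N g s) t^-1 by rewrite conjgE ct mulKg.
by apply: commuteV; case: ts => ->; last apply: commuteV.
Qed.

(* Deleting from a word for [g] every letter that crosses the wall [r] produces
   a word for [(N g r)^-1 * g]. *)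
Lemma cocycle_deletion Y n g r : Y `<=` X -> word_length Y n g ->
  exists m g0, [/\ word_length Y m g0, g = N g r * g0,
    m <= n & N g r != 1 -> m < n].
Proof.
move=> YX wg; elim: wg r => [|k s t g' Ys ts wg' IH] r.
  exists 0%N, 1; split=> //; first exact: word_length0.
    by rewrite cocycle1 mulg1.
  by rewrite cocycle1 eqxx.
have [m [g0 [w0 e0 le0 lt0]]] := IH (r ^ t).
have Xs := YX _ Ys; rewrite NM (cocycle_letter _ Xs ts).
case: eqP => [rs|_].
  have rt : r ^ t = r by rewrite rs; apply: letter_fix.
  rewrite rt in e0 *; exists m, g0; split=> //; last exact: leqW.
  by rewrite rs (cocycle_letter_fix (word_length_sub YX wg') ts) -rs
    -mulgA -e0.
exists m.+1, (t * g0); split; first exact: word_lengthS ts w0.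
- by rewrite mul1g {1}e0 /conjg invgK mulgA !mulgA mulgVK.
- by rewrite ltnS.
- by rewrite mul1g conjg_eq1 ltnS.
Qed.

(** A wall crossed by a word is the conjugate of one of its letters by the prefix before that
    letter. *)
Lemma cocycle_supp Y n g r : Y `<=` X -> word_length Y n g ->
  N g r != 1 -> gen_subgroup Y r.
Proof.
move=> YX wg; elim: wg r => [|k s t g' Ys ts wg' IH] r.
  by rewrite cocycle1 eqxx.
have sgY := gen_is_subgroup Y.
rewrite NM (cocycle_letter _ (YX _ Ys) ts); have [-> _|_] := eqVneq r s.
  exact: mem_gen.
rewrite mul1g conjg_eq1 => /IH Yrt; rewrite -(conjgK t r).
apply: (subgroupJ sgY Yrt); apply: (subgroupV sgY).
by case: ts => ->; [|apply: (subgroupV sgY)]; apply: mem_gen.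
Qed.

(** Take [d] shortest in the coset [D_Y g]. If [N d r != 1] with [r] in [D_Y], deletion makes
    [(N d r)^-1 * d] strictly shorter, and it lies in the same coset because [N d r] is a power of
    [r]. *)
Lemma shortest_coset_rep Y g : Y `<=` X ->
  exists a d, [/\ gen_subgroup Y a, g = a * d &
    forall r, gen_subgroup Y r -> N d r = 1].
Proof.
move=> YX; have sgY := gen_is_subgroup Y.
pose P n := `[< exists2 d, word_length X n d & gen_subgroup Y (g * d^-1) >].
have exP : exists n, P n.
  have /gen_word_length[n wg] : gen_subgroup X g by rewrite genX.
  exists n; apply/asboolP; exists g => //; rewrite mulgV.
  exact: (subgroup1 sgY).
case: (ex_minnP exP) => n /asboolP[d wd Yd] minn.
exists (g * d^-1), d; split=> // [|r Yr]; first by rewrite mulgVK.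
apply/eqP/negPn/negP => Ndr.
have [m [d0 [w0 e0 _ /(_ Ndr)]]] := cocycle_deletion r (@subset_refl _ X) wd.
rewrite ltnNge => /negP; apply; apply: minn; apply/asboolP; exists d0 => //.
have -> : d0 = (N d r)^-1 * d by rewrite {2}e0 mulKg.
rewrite invgM invgK mulgA; apply: (subgroupM sgY Yd).
exact: cocycle_mem wd sgY Yr.
Qed.

(** Induction on the length of a word over [Y] for [x], with first letter [s]: split off [N x s], a
    power of [s], leaving a shorter word. If this power is nontrivial, then [s] itself lies in
    [H]. *)
Lemma gen_inter_conj Y Z d : Y `<=` X -> Z `<=` X ->
    (forall r, gen_subgroup Y r -> N d r = 1) ->
  let H := [set x | gen_subgroup Y x /\ gen_subgroup Z (x ^ d)] in
  H = gen_subgroup (Y `&` H).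
Proof.
move=> YX ZX Nd H; have sgY := gen_is_subgroup Y.
have sgZ := gen_is_subgroup Z.
have sgH : is_subgroup H.
  have /is_subgroupP[c1 cB] := subgroup_conj d sgZ.
  apply/is_subgroupP; split; first by split=> //; apply: (subgroup1 sgY).
  move=> u v [Yu Zu] [Yv Zv]; split; last exact: cB.
  by apply: (subgroupM sgY) => //; apply: (subgroupV sgY).
have sgYH := gen_is_subgroup (Y `&` H).
apply/seteqP; split; last by apply: gen_subset => // x [].
move=> x Hx; have [n] : exists n, word_length Y n x.
  by apply/gen_word_length; case: Hx.
elim/ltn_ind: n x Hx => n IH x Hx wx.
case: n x / wx IH Hx => [|k s t x' Ys ts wx'] IH Hx.
  exact: (subgroup1 sgYH).
have Xs := YX _ Ys.
(* The weak bound [m <= k] suffices, as the first letter [t] is absorbed into [N (t * x') s] as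
   well. *)
have [m [x0 [w0 e0 lemk _]]] := cocycle_deletion s YX wx'.
have stE : N (t * x') s * x0 = t * x'.
  rewrite NM (cocycle_letter _ Xs ts) eqxx (letter_fix ts).
  rewrite (cocycle_letter_fix (word_length_sub YX wx') ts).
  by rewrite -mulgA -e0.
have [e1|ne1] := eqVneq (N (t * x') s) 1.
  by rewrite -stE e1 mul1g; apply: (IH m) => //; rewrite -[x0]mul1g -e1 stE.
have Hs : H s.
  split; first exact: mem_gen.
  set x := t * x' in Hx stE ne1 *.
  have /gen_word_length[j wz] := Hx.2.
  (* As [N d] vanishes at [s] and at [s ^ x], both in [D_Y], expanding [N] on [x * d = d * (x ^ d)]
     makes [N x s] a conjugate of [N (x ^ d) (s ^ d)]. Hence the latter is nontrivial and [s ^ d]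
     lies in [D_Z]. *)
  apply: (cocycle_supp ZX wz); apply: contra_neq ne1 => Nz.
  have xd : x * d = d * (x ^ d) by rewrite -conjgC.
  have := NM x d s; rewrite xd NM (Nd s (mem_gen Ys)) Nz.
  have -> : N d (s ^ x) = 1 by apply: Nd (subgroupJ sgY (mem_gen Ys) Hx.1).
  by rewrite !conj1g !mulg1.
have Hxs : H (N (t * x') s).
  apply: (cocycle_mem _ sgH Hs).
  exact: word_lengthS (YX _ Ys) ts (word_length_sub YX wx').
have YHx : gen_subgroup (Y `&` H) (N (t * x') s).
  apply: (cocycle_mem _ sgYH); last by apply: mem_gen.
  exact: word_lengthS (YX _ Ys) ts (word_length_sub YX wx').
rewrite -stE; apply: (subgroupM sgYH YHx); apply: (IH m) => //.
by apply: (subgroupMl sgH Hxs); rewrite stE.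
Qed.

(** * Intersections of parabolic subgroups and parabolic closures *)

Lemma mem_parabolic Y g x :
  [set g * h * g^-1 | h in gen_subgroup Y] x <-> gen_subgroup Y (x ^ g).
Proof.
split=> [[h Yh <-]|Yx].
  by rewrite -mulgA -{1}[g]invgK -/(conjg h g^-1) conjgKV.
by exists (x ^ g) => //; rewrite -mulgA -{1}[g]invgK -/(conjg _ g^-1) conjgK.
Qed.

Lemma parabolic_inter Y Z g1 g2 : Y `<=` X -> Z `<=` X ->
  exists a Y', [/\ Y' `<=` Y, gen_subgroup Y a & forall x,
    gen_subgroup Y' (x ^ (g1 * a)) <->
    gen_subgroup Y (x ^ g1) /\ gen_subgroup Z (x ^ g2)].
Proof.
move=> YX ZX; have sgY := gen_is_subgroup Y.
have [a [d [Ya g12 Nd]]] := shortest_coset_rep (g1^-1 * g2) YX.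
have := gen_inter_conj YX ZX Nd; set H := [set x | _] => HE.
exists a, (Y `&` H); split=> [x [] //|//|x]; rewrite -HE /H /=.
(* Here [g1 * a * d = g2], and conjugating by [a] in [D_Y] preserves membership in [D_Y]. *)
rewrite -[(x ^ _) ^ d]conjgM -mulgA -g12 mulVKg conjgM.
by split=> -[Yx Zx]; split=> //; [rewrite -(conjgK a (x ^ g1))|];
  apply: (subgroupJ sgY) => //; apply: (subgroupV sgY).
Qed.

Lemma parabolic_closure_exists (V : finType) (v : V -> D) g :
  range v = X -> exists P, parabolic_closure X g P.
Proof.
(* The rank is counted on the finite index type [V], because [X] is only a set in [D]. *)
move=> vX; pose rk Y := #|finset (fun i => `[< Y (v i) >])|.
pose P n := `[< exists h Y, [/\ Y `<=` X, gen_subgroup Y (g ^ h) & rk Y = n] >].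
have exP : exists n, P n.
  by exists (rk X); apply/asboolP; exists 1, X; split=> //; rewrite genX.
case: (ex_minnP exP) => _ /asboolP[h [Y [YX Yg <-]]] minn.
exists [set h * x * h^-1 | x in gen_subgroup Y]; split.
- by exists h, Y.
- exact/mem_parabolic.
move=> _ [k [Z [ZX ->]]] /mem_parabolic Zg x /mem_parabolic Yx.
have [a [Y' [Y'Y Ya eY']]] := parabolic_inter h k YX ZX.
apply/mem_parabolic;
suff [] : gen_subgroup Y (x ^ h) /\ gen_subgroup Z (x ^ k) by [].
apply/eY'; suff -> : Y' = Y.
  by rewrite conjgM; apply: subgroupJ (gen_is_subgroup Y) Yx Ya.
have Y'X : Y' `<=` X := subset_trans Y'Y YX.
(* The intersection is a conjugate of [D_Y'] and contains [g], so minimality bounds its rank from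
   below; with [Y'] inside [Y] this forces equality. *)
have rkY : rk Y <= rk Y'.
  apply: minn; apply/asboolP; exists (h * a), Y'; split=> //.
  exact/eY'.
have /eqP/setP eqYY' :
    finset (fun i => `[< Y' (v i) >]) == finset (fun i => `[< Y (v i) >]).
  rewrite eqEcard rkY andbT; apply/fintype.subsetP => i; rewrite !finset.in_set.
  move=> /asboolP Y'i; apply/asboolP. exact: Y'Y.
apply/seteqP; split=> // y Yy; have := YX _ Yy; rewrite -vX => -[i _ vi].
by have := eqYY' i; rewrite !finset.in_set vi => e; apply/asboolP;
  rewrite e; apply/asboolP.
Qed.

End WallCocycle.

(** * Construction of the wall cocycle of a Dyer group *)

Lemma mulg_expC (D : groupType) (a b : D) n :
  (a * (b * a) ^+ n = (a * b) ^+ n * a)%g.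
Proof.
elim: n => [|n IH]; first by rewrite !expg0 mulg1 mul1g.
by rewrite expgS !mulgA -(mulgA (a * b)%g) IH mulgA -expgS.
Qed.

Section DyerCocycle.
Local Open Scope group_scope.
Variables (D : groupType) (G : dyer_graph).
Variable phi : {multiplicative dyer_group G -> D}.
Implicit Types (w : word (dyer_vertex G)) (u v : dyer_vertex G) (a b r : D).

Definition word_eval w : D := phi (pres_class (@dyer_rel G) w).

Lemma word_eval_eq w w' :
  pres_eq (@dyer_rel G) w w' -> word_eval w = word_eval w'.
Proof. by move=> e; congr (phi _); apply/pres_classP. Qed.

Lemma word_eval_cat w w' : word_eval (w ++ w') = word_eval w * word_eval w'.
Proof. by rewrite /word_eval pres_class_cat gmulfM. Qed.

Lemma word_eval_nil : word_eval [::] = 1.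
Proof. by apply: (@mulgI _ (word_eval [::])); rewrite mulg1 -word_eval_cat. Qed.

Lemma word_eval_cons l w : word_eval (l :: w) = word_eval [:: l] * word_eval w.
Proof. by rewrite -word_eval_cat. Qed.

Definition gen_eval v := word_eval [:: (v, true)].

Lemma word_eval_inv v : word_eval [:: (v, false)] = (gen_eval v)^-1.
Proof.
apply/eqP; rewrite -mulg_eq1 -word_eval_cat.
by rewrite (word_eval_eq (pres_cancel _ v false)) word_eval_nil.
Qed.

(* The power of [r] accumulated when the path read along [w] from [1] crosses
   the wall of [r]; it is trivial when [r] is not a conjugate of a generator. *)
Fixpoint wall_value w r : D :=
  if w is l :: w' then
    let t := word_eval [:: l] in
    (if r == gen_eval l.1 then t else 1) * wall_value w' (r ^ t) ^ t^-1
  else 1.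

Lemma wall_value_cat w w' r : wall_value (w ++ w') r =
  wall_value w r * wall_value w' (r ^ word_eval w) ^ (word_eval w)^-1.
Proof.
elim: w r => [|l w IH] r /=.
  by rewrite word_eval_nil invg1 !conjg1 mul1g.
by rewrite IH (word_eval_cons l w) invgM !conjgM conjMg mulgA.
Qed.

(** A generator fixes its own wall, so each letter crosses that wall and no other. *)
Lemma wall_value_nseq v n r :
  wall_value (nseq n (v, true)) r = if r == gen_eval v then r ^+ n else 1.
Proof.
elim: n r => [|n IH] r /=; first by rewrite expg0 if_same.
rewrite IH -/(gen_eval v); set a := gen_eval v.
have Ja : a ^ a = a by rewrite conjgE mulKg.
have -> : (r ^ a == a) = (r == a) by rewrite -{2}Ja (inj_eq (@conjg_inj _ a)).
have [->|_] := eqVneq r a; first by rewrite conjXg conjgK expgS.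
by rewrite conj1g mulg1.
Qed.

Lemma alt_wordS u v n :
  alt_word u v n.+1 = (u, true) :: alt_word v u n.
Proof.
rewrite /alt_word /mkseq /= -[1%N]/(1 + 0)%N iotaDl -map_comp; congr cons.
by apply: eq_map => i /=; case: (odd i).
Qed.

(* For involutions [a] and [b], the reflections crossed by [u v u ...] are the
   [(a b)^i a]. *)
Lemma wall_value_alt u v n r :
  let a := gen_eval u in let b := gen_eval v in a * a = 1 -> b * b = 1 ->
  wall_value (alt_word u v n) r =
  r ^+ (\sum_(0 <= i < n) (r == (a * b) ^+ i * a)%g)%N.
Proof.
elim: n u v r => [|n IH] u v r a b aa bb; first by rewrite big_geq.
rewrite alt_wordS /= -/(gen_eval u) -/a (IH v u _ bb aa) -/a -/b.
have Va : a^-1 = a by apply: mulg1_eq.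
rewrite big_nat_recl // expg0 mul1g conjXg conjgK expgnDr.
have -> : (if r == a then a else 1) = r ^+ (r == a) by case: eqP => [->|].
congr (_ * _ ^+ _); apply: eq_bigr => i _; congr nat_of_bool.
rewrite -[in RHS](inj_eq (@conjg_inj _ a)) expgSr.
have -> : (a * b) ^+ i * (a * b) * a = ((b * a) ^+ i * b) ^ a.
  by rewrite conjgE Va -!mulgA -(expgSr (b * a)) mulg_expC expgSr !mulgA.
by rewrite -(conjgM _ a) aa conjg1.
Qed.

(** For involutions, inverting a word reverses it, so the quotient is an alternating product of
    [2 n] letters. This turns a braid relation into [(a * b) ^+ n = 1]. *)
Lemma word_eval_alt u v n :
  let a := gen_eval u in let b := gen_eval v in a * a = 1 -> b * b = 1 ->
  word_eval (alt_word u v n) / word_eval (alt_word v u n) = (a * b) ^+ n.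
Proof.
elim: n u v => [|n IH] u v a b aa bb; first by rewrite mulgV.
have Vb : b^-1 = b by apply: mulg1_eq.
rewrite !alt_wordS (word_eval_cons (u, true)) (word_eval_cons (v, true)).
rewrite -/(gen_eval u) -/(gen_eval v) -/a -/b invgM Vb mulgA -(mulgA a).
by rewrite IH // -/a -/b mulg_expC -mulgA -expgSr.
Qed.

Lemma gen_eval_involution v : dyer_f v = Some 2 -> gen_eval v * gen_eval v = 1.
Proof.
move=> fv; rewrite -word_eval_nil -word_eval_cat; apply: word_eval_eq.
exact: pres_rel (dyer_rel_power fv).
Qed.

(** A vertex label at least 3 would make the edge label infinite. Thus braid relations along edges
    only involve involutions. *)
Lemma finite_edge_label2 u v n :
  dyer_edge u v -> dyer_m u v = Some n -> dyer_f v = Some 2.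
Proof.
move=> uv muv; have := dyer_f_ge2 v; have := @dyer_f_m G u v uv.
rewrite muv; case: (dyer_f v) => [k|] /= => [k3 k2|/(_ isT)//].
suff : ~~ (3 <= k) by rewrite -leqNgt => k2'; congr Some;
  apply/eqP; rewrite eqn_leq k2'.
by apply/negP => /k3.
Qed.

Lemma wall_value_braid u v n r :
  u != v -> dyer_ext_m u v = Some n ->
  wall_value (alt_word u v n) r = wall_value (alt_word v u n) r.
Proof.
move=> uneqv mn.
have := word_eval_eq (pres_rel (dyer_rel_braid uneqv mn)).
move: mn; rewrite /dyer_ext_m; case: ifPn => [uv mn|nuv [<-]] eAB.
  have bb := gen_eval_involution (finite_edge_label2 uv mn).
  have aa : gen_eval u * gen_eval u = 1.
    apply/gen_eval_involution/(@finite_edge_label2 v u n).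
      by rewrite dyer_edge_sym.
    by rewrite -dyer_m_sym.
  have abn := word_eval_alt n aa bb; rewrite eAB mulgV in abn.
  rewrite !wall_value_alt //; congr (_ ^+ _); rewrite big_nat_rev /=.
  set a := gen_eval u in aa abn *; set b := gen_eval v in bb abn *.
  apply: eq_big_nat => i /andP[_ ltin]; congr nat_of_bool; congr (_ == _).
  have -> : (b * a) ^+ i * b = (b * a) ^+ i.+1 * a.
    by rewrite expgSr -!mulgA aa mulg1.
  (* Since [(a * b) ^+ n = 1] and [b * a] is inverse to [a * b], the wall at position [i] on one
     side is the wall at position [n - i - 1] on the other. *)
  congr (_ * _); apply/eqP; rewrite -divg_eq1 -expVgn invgM.
  by rewrite (mulg1_eq aa) (mulg1_eq bb) -expgnDr add0n subnK // -abn.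
(* Without an edge the two generators commute, so each fixes the wall of the other, whatever their
   orders. *)
rewrite !alt_wordS /= !conj1g !mulg1 -/(gen_eval u) -/(gen_eval v).
have {eAB} : commute (gen_eval u) (gen_eval v).
  by rewrite /commute -!word_eval_cat.
set a := gen_eval u; set b := gen_eval v => ab.
have Jba : b ^ a = b by rewrite conjgE -ab mulKg.
have Jab : a ^ b = a by rewrite conjgE ab mulKg.
have -> : (r ^ a == b) = (r == b) by rewrite -{1}Jba (inj_eq (@conjg_inj _ a)).
have -> : (r ^ b == a) = (r == a) by rewrite -{1}Jab (inj_eq (@conjg_inj _ b)).
have -> : (if r == b then b else 1) ^ a^-1 = if r == b then b else 1.
  by case: ifP => _; rewrite ?conj1g // -{1}Jba conjgK.
have -> : (if r == a then a else 1) ^ b^-1 = if r == a then a else 1.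
  by case: ifP => _; rewrite ?conj1g // -{1}Jab conjgK.
by case: ifP => _; case: ifP => _; rewrite ?mulg1 ?mul1g.
Qed.

Lemma wall_value_eq w w' :
  pres_eq (@dyer_rel G) w w' -> wall_value w =1 wall_value w'.
Proof.
elim=> [//|{}w {}w' _ e r|{}w w1 {}w' _ e _ e' r
       |u u' {}w {}w' eu IHu _ IHw r|v b r|{}w {}w'].
- by rewrite e.
- by rewrite e.
- by rewrite !wall_value_cat IHu IHw (word_eval_eq eu).
- rewrite /= conj1g mulg1; set a := gen_eval v.
  have Ja : a ^ a = a by rewrite conjgE mulKg.
  have JV : a ^ a^-1 = a by rewrite -{1}Ja conjgK.
  have -> : word_eval [:: (v, ~~ b)] = (word_eval [:: (v, b)])^-1.
    by case: b; rewrite ?word_eval_inv ?invgK.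
  have tE : a ^ word_eval [:: (v, b)] = a by case: b; rewrite ?word_eval_inv.
  set t := word_eval _ in tE *.
  have -> : (r ^ t == a) = (r == a) by rewrite -{1}tE (inj_eq (@conjg_inj _ t)).
  case: eqP => _; last by rewrite conj1g mulg1.
  by rewrite conjgE mulKg mulgV.
- case=> [v n fv|u v n uv mn] r; last exact: wall_value_braid.
  (* The only possibly nontrivial value is [gen_eval v ^+ n], which the power relation kills in
     [D]. *)
  rewrite wall_value_nseq; case: eqP => [->|//].
  have evn m : word_eval (nseq m (v, true)) = gen_eval v ^+ m.
    elim: m => [|m IH]; first exact: word_eval_nil.
    by rewrite /= word_eval_cons IH expgS.
  by rewrite -evn (word_eval_eq (pres_rel (dyer_rel_power fv))) word_eval_nil.
Qed.

Variable psi : D -> dyer_group G.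
Hypothesis psiK : cancel psi phi.
Hypothesis phiK : cancel phi psi.

(** By [wall_value_eq] the value does not depend on the word chosen by [repr]. *)
Definition wall_cocycle (g r : D) : D := wall_value (repr (psi g)) r.

Lemma wall_cocycle_eval w r : wall_cocycle (word_eval w) r = wall_value w r.
Proof. by apply: wall_value_eq; rewrite phiK; apply: pres_repr_class. Qed.

Lemma word_eval_repr g : word_eval (repr (psi g)) = g.
Proof. by rewrite /word_eval pres_class_repr psiK. Qed.

Lemma wall_cocycleM g h r :
  wall_cocycle (g * h) r = wall_cocycle g r * wall_cocycle h (r ^ g) ^ g^-1.
Proof.
rewrite -[g]word_eval_repr -[h]word_eval_repr -word_eval_cat.
by rewrite !wall_cocycle_eval wall_value_cat.
Qed.

Lemma wall_cocycle_gen v r :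
  wall_cocycle (gen_eval v) r = if r == gen_eval v then gen_eval v else 1.
Proof. by rewrite wall_cocycle_eval /= conj1g mulg1. Qed.

End DyerCocycle.

(** * Parabolic closures in Dyer systems *)

Theorem corollaryF (D : groupType) (X : set D) (HX : dyer_system X) (g : D) :
  exists P : set D, parabolic_closure X g P.
Proof.
case: HX => genX [G [phi [[psi phiK psiK] [genX' _ surjX]]]].
have rangeX : range (gen_eval phi) = X.
  apply/seteqP; split=> [_ [v _ <-]|s Xs]; first exact: genX'.
  by have [v _ <-] := surjX s Xs; exists v.
apply: (parabolic_closure_exists genX (wall_cocycleM psiK phiK) _ g rangeX).
by move=> s r; rewrite -rangeX => -[v _ <-]; apply: wall_cocycle_gen.
Qed.
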